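(* Let $n,B\ge 1$ and let $(\mathbf X_n,\mathbf Y_n,\mathbf Z_n)=(X_i,Y_i,Z_i)_{i=1}^n$ be an i.i.d. sample from the distribution of $(X,Y,Z)$. Let $T(\cdot)$ be any real-valued statistic defined on samples of size $n$, let $(\mathbf X^*_{n,b},\mathbf Y_n,\mathbf Z_n)$, $b=1,\dots,B$, be $B$ samples obtained from $(\mathbf X_n,\mathbf Y_n,\mathbf Z_n)$ by the Conditional Permutation scheme, using $B$ independent permutations, and put $T=T(\mathbf X_n,\mathbf Y_n,\mathbf Z_n)$ and $T_b^*=T(\mathbf X_{n,b}^*,\mathbf Y_n,\mathbf Z_n)$. If the null hypothesis $H_0$ that $X$ and $Y$ are conditionally independent given $Z$ holds, then for every $\alpha\in[0,1]$ $$P\left(\frac{1+\sum_{b=1}^B \mathbb I(T\le T_b^* )}{1+B}\le \alpha\right)\le \alpha .$$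
   Context: $(X,Y,Z)$ is a discrete random triple with values in $\mathcal X\times\mathcal Y\times\mathcal Z$, where $\mathcal X,\mathcal Y,\mathcal Z$ are finite sets, and $p(x,y,z)=P(X=x,Y=y,Z=z)>0$ for all $(x,y,z)\in\mathcal X\times\mathcal Y\times\mathcal Z$. $\mathbb I$ denotes the indicator. Conditional Permutation (CP) scheme: given the sample $(X_i,Y_i,Z_i)_{i=1}^n$, let $\Pi$ be the set of all permutations $\pi$ of $\{1,\dots,n\}$ that preserve each stratum $\{i: Z_i=z\}$, $z\in\mathcal Z$ (i.e. $Z_{\pi(i)}=Z_i$ for all $i$). A CP sample is $(X_{\pi(i)},Y_i,Z_i)_{i=1}^n$, where $\pi$ is drawn uniformly at random from $\Pi$; given $\mathbf Z_n$, the permutation is drawn independently of $(\mathbf X_n,\mathbf Y_n)$. The $B$ permutations used for the $B$ samples are drawn independently of each other (given $\mathbf Z_n$) in this way. *)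

(* Defs.v *)
From HB Require Import structures.
From mathcomp Require Export all_boot all_order all_fingroup all_algebra.
From mathcomp Require Export all_classical all_reals all_analysis.

Set Implicit Arguments.
Unset Strict Implicit.
Unset Printing Implicit Defensive.

Import Order.TTheory GRing.Theory Num.Theory.

Local Open Scope classical_set_scope.
Local Open Scope ring_scope.

(* Random elements of a finite type, which carries the discrete sigma-algebra. *)
Definition discrete_rv (d : measure_display) (Om : measurableType d)
    (F : finType) (U : Om -> F) : Prop :=
  forall A : set F, measurable (U @^-1` A).

Definition prob (d : measure_display) (Om : measurableType d) (R : realType)
    (P : probability Om R) (A : set Om) : R := fine (P A).

(* P (A | C); equal to 0 when C is a null event, but only used for 0 < P C. *)
Definition cprob (d : measure_display) (Om : measurableType d) (R : realType)
    (P : probability Om R) (C A : set Om) : R :=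
  prob P (A `&` C) / prob P C.

Definition same_law (d d0 : measure_display) (Om : measurableType d)
    (Om0 : measurableType d0) (R : realType) (P : probability Om R)
    (P0 : probability Om0 R) (F : finType) (U : Om -> F) (U0 : Om0 -> F) : Prop :=
  forall A : set F, prob P (U @^-1` A) = prob P0 (U0 @^-1` A).

(* In the next two definitions Q is meant to be prob P, or cprob P C for
   independence conditionally on the event C. *)
Definition mutually_indep (Om : Type) (R : realType) (Q : set Om -> R)
    (I F : finType) (U : I -> Om -> F) : Prop :=
  forall (J : {set I}) (A : I -> set F),
    Q [set w | forall i, i \in J -> A i (U i w)]
    = \prod_(i in J) Q (U i @^-1` A i).

Definition indep (Om : Type) (R : realType) (Q : set Om -> R)
    (F G : finType) (U : Om -> F) (V : Om -> G) : Prop :=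
  forall (A : set F) (B : set G),
    Q ((U @^-1` A) `&` (V @^-1` B)) = Q (U @^-1` A) * Q (V @^-1` B).

Definition cond_indep (d : measure_display) (Om : measurableType d)
    (R : realType) (P : probability Om R) (F G H : finType)
    (U : Om -> F) (V : Om -> G) (W : Om -> H) : Prop :=
  forall h : H, 0 < prob P (W @^-1` [set h]) ->
    indep (cprob P (W @^-1` [set h])) U V.

Definition mutually_cond_indep (d : measure_display) (Om : measurableType d)
    (R : realType) (P : probability Om R) (I F H : finType)
    (U : I -> Om -> F) (W : Om -> H) : Prop :=
  forall h : H, 0 < prob P (W @^-1` [set h]) ->
    mutually_indep (cprob P (W @^-1` [set h])) U.

Definition iid_copies (d d0 : measure_display) (Om : measurableType d)
    (Om0 : measurableType d0) (R : realType) (P : probability Om R)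
    (P0 : probability Om0 R) (n : nat) (F : finType)
    (U : 'I_n -> Om -> F) (U0 : Om0 -> F) : Prop :=
  [/\ forall i, discrete_rv (U i),
      mutually_indep (prob P) U
    & forall i, same_law P P0 (U i) U0].

Definition rvec (Om : Type) (n : nat) (F : finType) (U : 'I_n -> Om -> F)
    (w : Om) : {ffun 'I_n -> F} := [ffun i => U i w].

Definition stratum_perms (n : nat) (TZ : finType) (z : {ffun 'I_n -> TZ}) :
    {set {perm 'I_n}} := [set s : {perm 'I_n} | [forall i, z (s i) == z i]].

Definition permute (n : nat) (F : finType) (s : {perm 'I_n})
    (x : {ffun 'I_n -> F}) : {ffun 'I_n -> F} := [ffun i => x (s i)].

(* The random permutations pi_b, b < B, of the Conditional Permutation scheme
   for the sample (X, Y, Z): given Z, each pi_b is uniform on the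
   stratum-preserving permutations, the pi_b are mutually independent, and the
   family (pi_b)_b is independent of (X, Y). *)
Definition cp_scheme (d : measure_display) (Om : measurableType d)
    (R : realType) (P : probability Om R) (n B : nat) (TX TY TZ : finType)
    (X : Om -> {ffun 'I_n -> TX}) (Y : Om -> {ffun 'I_n -> TY})
    (Z : Om -> {ffun 'I_n -> TZ}) (pi : 'I_B -> Om -> {perm 'I_n}) : Prop :=
  [/\ forall b, discrete_rv (pi b),
      forall z, 0 < prob P (Z @^-1` [set z]) -> forall b s,
        cprob P (Z @^-1` [set z]) (pi b @^-1` [set s])
        = if s \in stratum_perms z then #|stratum_perms z|%:R^-1 else 0,
      mutually_cond_indep P pi Z
    & cond_indep P (rvec pi) (fun w => (X w, Y w)) Z].

(* Main.v *)
Require Import Defs.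

(** Set T_0 = T, and T_b = T_b^* for 1 <= b <= B. The p-value is at most alpha
    exactly when T_0 has at most alpha (B + 1) of the B + 1 values at or above
    it. Whatever the values are, at most alpha (B + 1) of the indices j have
    this property ([sum_rank_le]), so it suffices that T_0 be exchangeable
    with each T_j: the B + 1 events then have equal probability, and
    (B + 1) P(p-value <= alpha) <= alpha (B + 1) ([rank_prob_le]).

    Since all the data are finite, exchangeability can be read off the mass
    function p of the outcome v = (x, y, z, s), s being the B permutations.
    Write s_0 for the identity and view v as the list of B + 1 samples
    (x o s_k, y, z). Taking the j-th of them as the original data gives the
    outcome [rebase j v], with data x o s_j and permutations relative to s_j.
    This is an involution of the outcomes that exchanges T_0 and T_j
    ([cp_stat_rebase]), and it preserves p ([mass_rebase]) for two reasons:
    - p (x, y, z, s) is the mass of the sample (x, y, z) times a factor that is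
      constant on the families s of stratum-preserving permutations and zero
      elsewhere ([cp_mass], [prod_stratum_law]); those permutations form a
      group, so rebasing preserves this factor;
    - under conditional independence the mass of one observation is a product
      a(x, z) b(y, z) ([cond_indep_mass]), so the mass of an i.i.d. sample does
      not change when x is permuted within the strata of z ([prod_permute]). *)

Set Implicit Arguments.
Unset Strict Implicit.
Unset Printing Implicit Defensive.

Import Order.TTheory GRing.Theory Num.Theory.

Local Open Scope classical_set_scope.
Local Open Scope ring_scope.

(** * Ranks of exchangeable statistics *)

(** Among the indices whose rank is at most c, take one where t is minimal: all
    the others have values at or above it, so its rank, hence c, bounds how many
    they are. Ties do no harm because equal values count towards the rank. *)
Lemma sum_rank_le (R : realType) (I : finType) (t : I -> R) (c : R) :
  0 <= c -> \sum_j (\sum_k (t j <= t k)%R%:R <= c)%R%:R <= c.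
Proof.
move=> c0; pose rk j : R := \sum_k (t j <= t k)%R%:R.
have [[j0 j0P]|none] := boolp.pselect (exists j, rk j <= c); last first.
  rewrite big1 // => j _; rewrite -/(rk j).
  by case: (boolP (rk j <= c)) => // h; case: none; exists j.
case: (@Order.TotalTheory.arg_minP _ _ _ j0 (fun j => rk j <= c) t j0P) => i iP imin.
apply: le_trans iP; apply: ler_sum => j _.
rewrite -/(rk j); have [/imin ->//|_] := boolP (rk j <= c).
by rewrite ler0n.
Qed.

(** The symmetrisation argument on a finite probability space: phi j is a
    p-preserving relabelling of the outcomes under which the statistics 0 and j
    trade places, so the events that t j has rank at most c all have the same
    probability as j varies; their sum is the expectation of the count bounded
    by [sum_rank_le]. *)
Lemma rank_prob_le (R : realType) (V : finType) (p : V -> R) (m : nat)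
    (t : 'I_m.+1 -> V -> R) (phi : 'I_m.+1 -> V -> V) (c : R) :
  0 <= c -> (forall v, 0 <= p v) -> \sum_v p v = 1 ->
  (forall j, involutive (phi j)) ->
  (forall j v, p (phi j v) = p v) ->
  (forall j k v, t k (phi j v) = t (tperm ord0 j k) v) ->
  m.+1%:R * (\sum_(v | (\sum_k (t ord0 v <= t k v)%R%:R <= c)%R) p v) <= c.
Proof.
move=> c0 p0 p1 phiK pphi tphi.
pose I j v : R := (\sum_k (t j v <= t k v)%R%:R <= c)%R%:R.
have swap j : \sum_v p v * I ord0 v = \sum_v p v * I j v.
  rewrite (reindex_inj (inv_inj (phiK j))) /=; apply: eq_bigr => v _.
  rewrite pphi; congr (_ * _).
  rewrite /I (reindex_inj (@perm_inj _ (tperm ord0 j))) /=.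
  rewrite (eq_bigr (fun k => (t j v <= t k v)%R%:R)) // => k _.
  by rewrite !tphi // tpermL tpermK.
have -> : \sum_(v | (\sum_k (t ord0 v <= t k v)%R%:R <= c)%R) p v
          = \sum_v p v * I ord0 v.
  rewrite big_mkcond /=; apply: eq_bigr => v _; rewrite /I.
  by case: ifP; rewrite ?mulr1 ?mulr0.
have -> : m.+1%:R * (\sum_v p v * I ord0 v)
          = \sum_(j < m.+1) \sum_v p v * I j v.
  under [RHS]eq_bigr => j _ do rewrite -swap.
  by rewrite sumr_const card_ord mulr_natl.
rewrite exchange_big /= -[leRHS]mul1r -p1 mulr_suml; apply: ler_sum => v _.
by rewrite -mulr_sumr ler_wpM2l // sum_rank_le.
Qed.

(** * Random elements of a finite type *)

Section FiniteLaw.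
Variables (d : measure_display) (Om : measurableType d) (R : realType).
Variable P : probability Om R.

Lemma prob_ge0 (A : set Om) : 0 <= prob P A.
Proof. exact: fine_ge0. Qed.

Lemma prob_null (A C : set Om) : measurable A -> measurable C -> A `<=` C ->
  prob P C = 0 -> prob P A = 0.
Proof.
move=> mA mC AC C0; apply/eqP; rewrite eq_le prob_ge0 andbT -C0.
rewrite /prob fine_le ?fin_num_measure //.
by apply: le_measure => //; rewrite inE.
Qed.

Lemma discrete_rv_fibers (F : finType) (U : Om -> F) :
  (forall a, measurable (U @^-1` [set a])) -> discrete_rv U.
Proof.
move=> mU A; have -> : U @^-1` A = \bigcup_(a in A) (U @^-1` [set a]).
  by apply/seteqP; split => [w Aw|w [a Aa Ua]];
    [exists (U w) | rewrite /preimage /= Ua].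
by apply: fin_bigcup_measurable => //; exact: finite_finset.
Qed.

Lemma discrete_rv_pair (F G : finType) (U : Om -> F) (V : Om -> G) :
  discrete_rv U -> discrete_rv V -> discrete_rv (fun w => (U w, V w)).
Proof.
move=> mU mV; apply: discrete_rv_fibers => -[a b].
have -> : (fun w => (U w, V w)) @^-1` [set (a, b)]
          = (U @^-1` [set a]) `&` (V @^-1` [set b]).
  by apply/seteqP; split => w; [case=> <- <- | case=> /= <- <-].
exact: measurableI.
Qed.

Lemma discrete_rv_comp (F G : finType) (U : Om -> F) (f : F -> G) :
  discrete_rv U -> discrete_rv (fun w => f (U w)).
Proof. by move=> mU A; exact: (mU (f @^-1` A)). Qed.

(** Displays the event that a random vector takes a given value in the
    intersection form to which mutual independence applies. *)
Lemma rvec_fiber (n : nat) (F : finType) (U : 'I_n -> Om -> F) (u : {ffun 'I_n -> F}) :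
  rvec U @^-1` [set u] = [set w | forall i, i \in [set: 'I_n]%SET -> U i w = u i].
Proof.
apply/seteqP; split => w /= h; first by move=> i _; rewrite -h ffunE.
by apply/ffunP => i; rewrite ffunE h ?finset.in_setT.
Qed.

Lemma discrete_rv_rvec (n : nat) (F : finType) (U : 'I_n -> Om -> F) :
  (forall i, discrete_rv (U i)) -> discrete_rv (rvec U).
Proof.
move=> mU; apply: discrete_rv_fibers => u.
have -> : rvec U @^-1` [set u] = \bigcap_(i in [set: 'I_n]) (U i @^-1` [set u i]).
  rewrite rvec_fiber; apply/seteqP; split => w /= h i _; apply: h => //.
  by rewrite finset.in_setT.
by apply: fin_bigcap_measurable => // i _; exact: mU.
Qed.

Lemma prob_sum (F : finType) (U : Om -> F) (E : pred F) : discrete_rv U ->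
  prob P [set w | E (U w)] = \sum_(a | E a) prob P (U @^-1` [set a]).
Proof.
move=> mU.
have -> : [set w | E (U w)] = \bigcup_(a in [set` enum E]) (U @^-1` [set a]).
  apply/seteqP; split => [w Ew|w [a /= + /= ->]]; last by rewrite mem_enum.
  by exists (U w) => //=; rewrite mem_enum.
rewrite /prob measure_fin_bigcup //.
- rewrite -fsbig_seq ?enum_uniq // -sum_fine; last by move=> *; exact: fin_num_measure.
  rewrite big_enum /=; exact: eq_bigl.
- by move=> a b _ _ [w [/= <- <-]].
Qed.

Lemma prob_setT : prob P setT = 1.
Proof. by rewrite /prob probability_setT. Qed.


Lemma prob_cap (C A : set Om) :
  prob P C != 0 -> prob P (A `&` C) = cprob P C A * prob P C.
Proof. by move=> C0; rewrite /cprob divfK. Qed.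

End FiniteLaw.

(** * Mass functions of the sample and of the scheme *)

Lemma iid_mass (d d0 : measure_display) (Om : measurableType d)
    (Om0 : measurableType d0) (R : realType) (P : probability Om R)
    (P0 : probability Om0 R) (n : nat) (F : finType)
    (U : 'I_n -> Om -> F) (U0 : Om0 -> F) (u : {ffun 'I_n -> F}) :
  iid_copies P P0 U U0 ->
  prob P (rvec U @^-1` [set u]) = \prod_i prob P0 (U0 @^-1` [set u i]).
Proof.
case=> _ Uindep Ulaw; rewrite rvec_fiber.
rewrite (Uindep [set: 'I_n]%SET (fun i => [set u i])).
by apply: eq_big => [i|i _]; rewrite ?finset.in_setT // Ulaw.
Qed.

(** The factors are a x z = P(X = x | Z = z) and b y z = P(Y = y, Z = z). *)
Lemma cond_indep_mass (d : measure_display) (Om : measurableType d)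
    (R : realType) (P : probability Om R) (F G H : finType)
    (X : Om -> F) (Y : Om -> G) (Z : Om -> H) :
  discrete_rv X -> discrete_rv Y -> discrete_rv Z -> cond_indep P X Y Z ->
  exists a b, forall x y z,
    prob P ((fun w => (X w, Y w, Z w)) @^-1` [set (x, y, z)]) = a x z * b y z.
Proof.
move=> mX mY mZ XYZ; pose C z := Z @^-1` [set z].
exists (fun x z => cprob P (C z) (X @^-1` [set x])).
exists (fun y z => cprob P (C z) (Y @^-1` [set y]) * prob P (C z)) => x y z.
have -> : (fun w => (X w, Y w, Z w)) @^-1` [set (x, y, z)]
          = (X @^-1` [set x] `&` Y @^-1` [set y]) `&` C z.
  by apply/seteqP; split => w; [case=> <- <- <- | case=> -[/= <- <-] <-].
have [C0|C0] := eqVneq (prob P (C z)) 0.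
  (* Nothing is known conditionally on a null stratum; both sides vanish. *)
  rewrite C0 !mulr0; apply: (prob_null _ (mZ [set z]) _ C0).
    by apply: measurableI; [exact: measurableI | exact: mZ].
  exact: subIsetr.
by rewrite prob_cap // XYZ ?mulrA // lt0r C0 prob_ge0.
Qed.

Section Strata.
Variables (n : nat) (TZ : finType) (z : {ffun 'I_n -> TZ}).

Lemma stratum_permsP (s : {perm 'I_n}) :
  reflect (forall i, z (s i) = z i) (s \in stratum_perms z).
Proof. by rewrite inE; apply: (iffP forallP) => h i; apply/eqP; apply: h. Qed.

Lemma group_set_stratum_perms : group_set (stratum_perms z).
Proof.
apply/group_setP; split=> [|s t /stratum_permsP sz /stratum_permsP tz].
  by apply/stratum_permsP => i; rewrite perm1.
by apply/stratum_permsP => i; rewrite permM tz sz.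
Qed.

Canonical stratum_perms_group := Group group_set_stratum_perms.

(** The factors b see the same arguments on both sides; in the factors a,
    replacing z i by z (s i) turns the product into a reindexing by s. *)
Lemma prod_permute (R : comPzRingType) (F G : Type)
  (a : F -> TZ -> R) (b : G -> TZ -> R) (s : {perm 'I_n})
  (x : 'I_n -> F) (y : 'I_n -> G) :
  s \in stratum_perms z ->
  \prod_i (a (x (s i)) (z i) * b (y i) (z i))
  = \prod_i (a (x i) (z i) * b (y i) (z i)).
Proof.
move=> /stratum_permsP sz; rewrite !big_split /=; congr (_ * _).
rewrite [RHS](reindex_inj (@perm_inj _ s)) /=.
by apply: eq_bigr => i _; rewrite sz.
Qed.

Definition stratum_law (R : realType) (s : {perm 'I_n}) : R :=
  if s \in stratum_perms z then #|stratum_perms z|%:R^-1 else 0.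

Lemma prod_stratum_law (R : realType) (B : nat) (s : {ffun 'I_B -> {perm 'I_n}}) :
  \prod_b stratum_law R (s b)
  = if [forall b, s b \in stratum_perms z] then #|stratum_perms z|%:R^-1 ^+ B else 0.
Proof.
case: ifPn => [/forallP sz|/forallPn[b sb]].
  rewrite -[in RHS](card_ord B) -prodr_const; apply: eq_bigr => b _.
  by rewrite /stratum_law sz.
by rewrite (bigD1 b) //= /stratum_law (negbTE sb) mul0r.
Qed.

End Strata.

(** The permutations depend on the data only through z, so conditioning on
    Z = z splits off their law, which is a product of uniform laws on the
    stratum-preserving permutations. *)
Lemma cp_mass (d : measure_display) (Om : measurableType d)
    (R : realType) (P : probability Om R) (n B : nat) (TX TY TZ : finType)
    (X : Om -> {ffun 'I_n -> TX}) (Y : Om -> {ffun 'I_n -> TY})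
    (Z : Om -> {ffun 'I_n -> TZ}) (pi : 'I_B -> Om -> {perm 'I_n}) x y z s :
  discrete_rv X -> discrete_rv Y -> discrete_rv Z -> cp_scheme P X Y Z pi ->
  prob P ((fun w => (X w, Y w, Z w, rvec pi w)) @^-1` [set (x, y, z, s)])
  = prob P ((fun w => (X w, Y w, Z w)) @^-1` [set (x, y, z)])
    * \prod_b stratum_law z R (s b).
Proof.
move=> mX mY mZ [mpi unif piindep piXY]; pose C := Z @^-1` [set z].
have mC : measurable C by exact: mZ.
pose XY w := (X w, Y w).
have mXY : discrete_rv XY by exact: discrete_rv_pair.
have mrpi := discrete_rv_rvec mpi.
have -> : (fun w => (X w, Y w, Z w)) @^-1` [set (x, y, z)]
          = XY @^-1` [set (x, y)] `&` C.
  by rewrite /C; apply/seteqP; split => w; [case=> <- <- <- | case=> -[<- <-] /= <-].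
have -> : (fun w => (X w, Y w, Z w, rvec pi w)) @^-1` [set (x, y, z, s)]
          = (rvec pi @^-1` [set s] `&` XY @^-1` [set (x, y)]) `&` C.
  rewrite /C; apply/seteqP; split => w; first by case=> <- <- <- <-.
  by case=> -[/= <-] [<- <-] <-.
have [C0|C0] := eqVneq (prob P C) 0.
  have null D : measurable D -> prob P (D `&` C) = 0.
    move=> mD; apply: (prob_null (measurableI _ _ mD mC) mC _ C0).
    exact: subIsetr.
  rewrite (null _ (mXY _)) mul0r null //.
  exact: (measurableI _ _ (mrpi _) (mXY _)).
have Cgt0 : 0 < prob P C by rewrite lt0r C0 prob_ge0.
rewrite !prob_cap // piXY //.
suff -> : cprob P C (rvec pi @^-1` [set s]) = \prod_b stratum_law z R (s b).
  by rewrite -mulrA mulrC.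
rewrite rvec_fiber (piindep z Cgt0 [set: 'I_B]%SET (fun b => [set s b])).
by apply: eq_big => [b|b _]; rewrite ?finset.in_setT // unif.
Qed.

(** * Exchanging the original sample with a permuted one *)

Section Relabelling.
Variables (n B : nat) (TX TY TZ : finType).
Local Notation draws := {ffun 'I_B -> {perm 'I_n}}.
Local Notation outcome :=
  ({ffun 'I_n -> TX} * {ffun 'I_n -> TY} * {ffun 'I_n -> TZ} * draws)%type.

(** The drawn permutations preceded by the identity, so that the original
    sample becomes the permuted sample of index 0. *)
Definition with_id (s : draws) (k : 'I_B.+1) : {perm 'I_n} :=
  oapp s 1%g (unlift ord0 k).

Lemma with_id0 s : with_id s ord0 = 1%g.
Proof. by rewrite /with_id unlift_none. Qed.

Lemma with_id_lift s b : with_id s (lift ord0 b) = s b.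
Proof. by rewrite /with_id liftK. Qed.

(** The transposition moves the original sample to position j; the factor
    (s_j)^-1 compensates for x having been replaced by x o s_j. *)
Definition rebase_draws (j : 'I_B.+1) (s : draws) : draws :=
  [ffun b => with_id s (tperm ord0 j (lift ord0 b)) * (with_id s j)^-1]%g.

(** The new permutation of index 0 is s_j (s_j)^-1, that is, the identity: this
    is why no special case is needed at 0 (nor at j). *)
Lemma with_id_rebase j s k :
  with_id (rebase_draws j s) k = (with_id s (tperm ord0 j k) * (with_id s j)^-1)%g.
Proof.
case: (unliftP ord0 k) => [b ->|->]; first by rewrite with_id_lift ffunE.
by rewrite with_id0 tpermL mulgV.
Qed.

Lemma rebase_drawsK j : involutive (rebase_draws j).
Proof.
move=> s; apply/ffunP => b.
rewrite ffunE !with_id_rebase tpermR with_id0 tpermK with_id_lift.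
by rewrite mul1g invgK mulgVK.
Qed.

Lemma permute1 (F : finType) (x : {ffun 'I_n -> F}) : permute 1%g x = x.
Proof. by apply/ffunP => i; rewrite ffunE perm1. Qed.

Lemma permuteM (F : finType) (s t : {perm 'I_n}) (x : {ffun 'I_n -> F}) :
  permute s (permute t x) = permute (s * t)%g x.
Proof. by apply/ffunP => i; rewrite !ffunE permM. Qed.

Definition rebase (j : 'I_B.+1) (v : outcome) : outcome :=
  let: (x, y, z, s) := v in (permute (with_id s j) x, y, z, rebase_draws j s).

Lemma rebaseK j : involutive (rebase j).
Proof.
move=> [[[x y] z] s]; rewrite /rebase rebase_drawsK with_id_rebase tpermR.
by rewrite with_id0 mul1g permuteM mulVg permute1.
Qed.

Lemma stratum_rebase (z : {ffun 'I_n -> TZ}) j (s : draws) :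
  [forall b, s b \in stratum_perms z] ->
  with_id s j \in stratum_perms z /\
  [forall b, rebase_draws j s b \in stratum_perms z].
Proof.
move=> /forallP sz.
have wz k : with_id s k \in stratum_perms z.
  case: (unliftP ord0 k) => [b ->|->]; first by rewrite with_id_lift.
  by rewrite with_id0 group1.
by split=> //; apply/forallP => b; rewrite ffunE groupM ?groupV.
Qed.

Definition cp_stat (R : Type)
    (T : {ffun 'I_n -> TX} -> {ffun 'I_n -> TY} -> {ffun 'I_n -> TZ} -> R)
    (k : 'I_B.+1) (v : outcome) : R :=
  let: (x, y, z, s) := v in T (permute (with_id s k) x) y z.

Lemma cp_stat_rebase (R : Type) T j k v :
  @cp_stat R T k (rebase j v) = cp_stat T (tperm ord0 j k) v.
Proof.
by case: v => [[[x y] z] s] /=; rewrite permuteM with_id_rebase mulgVK.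
Qed.

(** When the permutations preserve the strata, so does s_j, and both factors of
    the mass are unchanged. Otherwise both masses are zero: rebasing is an
    involution that keeps stratum-preserving families so, hence it also keeps
    the other families outside. *)
Lemma mass_rebase (R : realType) (a : TX -> TZ -> R) (b : TY -> TZ -> R)
    (p : outcome -> R) :
  (forall x y z s, p (x, y, z, s) =
     \prod_i (a (x i) (z i) * b (y i) (z i)) * \prod_b stratum_law z R (s b)) ->
  forall j v, p (rebase j v) = p v.
Proof.
move=> pE j [[[x y] z] s]; rewrite /= !pE !prod_stratum_law.
have [sz|sz] := boolP [forall b, s b \in stratum_perms z].
  have [jz ->] := stratum_rebase j sz; congr (_ * _).
  rewrite -[RHS](prod_permute a b x y jz).
  by apply: eq_bigr => i _; rewrite ffunE.
rewrite mulr0 ifN ?mulr0 //; apply: contra sz => sz.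
by have [_] := stratum_rebase j sz; rewrite rebase_drawsK.
Qed.

End Relabelling.

Theorem theorem1 (R : realType) (TX TY TZ : finType)
  (* the triple (X, Y, Z) *)
  (d0 : measure_display) (Om0 : measurableType d0) (P0 : probability Om0 R)
  (X : Om0 -> TX) (Y : Om0 -> TY) (Z : Om0 -> TZ)
  (hX : discrete_rv X) (hY : discrete_rv Y) (hZ : discrete_rv Z)
  (hpos : forall x y z,
     0 < prob P0 [set w | [/\ X w = x, Y w = y & Z w = z]])
  (* the sample and the B permutations *)
  (n B : nat) (hn : (1 <= n)%N) (hB : (1 <= B)%N)
  (d : measure_display) (Om : measurableType d) (P : probability Om R)
  (Xs : 'I_n -> Om -> TX) (Ys : 'I_n -> Om -> TY) (Zs : 'I_n -> Om -> TZ)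
  (hiid : iid_copies P P0 (fun i w => (Xs i w, Ys i w, Zs i w))
            (fun w => (X w, Y w, Z w)))
  (pi : 'I_B -> Om -> {perm 'I_n})
  (hpi : cp_scheme P (rvec Xs) (rvec Ys) (rvec Zs) pi)
  (T : {ffun 'I_n -> TX} -> {ffun 'I_n -> TY} -> {ffun 'I_n -> TZ} -> R)
  (H0 : cond_indep P0 X Y Z)
  (alpha : R) (halpha : 0 <= alpha <= 1) :
  prob P [set w |
    (1 + \sum_(b < B)
           (T (rvec Xs w) (rvec Ys w) (rvec Zs w)
            <= T (permute (pi b w) (rvec Xs w)) (rvec Ys w) (rvec Zs w))%R%:R)
    / (1 + B%:R) <= alpha] <= alpha.
Proof.
have [a [b abE]] := cond_indep_mass hX hY hZ H0.
have [mS _ _] := hiid.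
have mX : discrete_rv (rvec Xs).
  by apply: discrete_rv_rvec => i; exact: (discrete_rv_comp (fun t => t.1.1) (mS i)).
have mY : discrete_rv (rvec Ys).
  by apply: discrete_rv_rvec => i; exact: (discrete_rv_comp (fun t => t.1.2) (mS i)).
have mZ : discrete_rv (rvec Zs).
  by apply: discrete_rv_rvec => i; exact: (discrete_rv_comp (fun t => t.2) (mS i)).
have [mpi _ _ _] := hpi.
pose V w := (rvec Xs w, rvec Ys w, rvec Zs w, rvec pi w).
have mV : discrete_rv V.
  apply: discrete_rv_pair; last exact: discrete_rv_rvec.
  by do 2! apply: discrete_rv_pair => //.
pose p v := prob P (V @^-1` [set v]).
have pE x y z s : p (x, y, z, s) =
    \prod_i (a (x i) (z i) * b (y i) (z i)) * \prod_b stratum_law z R (s b).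
  rewrite /p cp_mass //; congr (_ * _).
  transitivity (\prod_i prob P0 ((fun w => (X w, Y w, Z w)) @^-1`
                   [set [ffun i => (x i, y i, z i)] i])); last first.
    by apply: eq_bigr => i _; rewrite ffunE abE.
  rewrite -(iid_mass _ hiid); congr (prob P _); apply/seteqP; split => w /=.
    by case=> <- <- <-; apply/ffunP => i; rewrite !ffunE.
  move=> /ffunP e; congr (_, _, _); apply/ffunP => i;
    by have := e i; rewrite !ffunE => -[].
have p_sum1 : \sum_v p v = 1.
  by rewrite -(prob_setT P) -(prob_sum P predT mV); congr (prob P _); apply/seteqP.
have rankE w : \sum_k (cp_stat T ord0 (V w) <= cp_stat T k (V w))%R%:R
    = 1 + \sum_(b < B)
           (T (rvec Xs w) (rvec Ys w) (rvec Zs w)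
            <= T (permute (pi b w) (rvec Xs w)) (rvec Ys w) (rvec Zs w))%R%:R :> R.
  rewrite big_ord_recl lexx; congr (_ + _); apply: eq_bigr => k _ /=.
  by rewrite with_id0 permute1 with_id_lift ffunE.
have B0 : 0 < B.+1%:R :> R by rewrite ltr0n.
have c0 : 0 <= alpha * B.+1%:R by case/andP: halpha => ? _; rewrite mulr_ge0 ?ler0n.
under eq_set => w do rewrite nat1r ler_pdivrMr // -rankE.
have := rank_prob_le c0 (fun v => prob_ge0 P _) p_sum1 (@rebaseK n B TX TY TZ)
  (mass_rebase pE) (cp_stat_rebase T).
by rewrite mulrC ler_pM2r // -(prob_sum P _ mV).
Qed.
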